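(* Let $\mathcal{A}$ be an algebra in the real quaternions $\mathbb{H}$ and let $p,q\in\mathcal{A}'$. Then the family $$\mathcal{G}_{p,q}[\mathcal{A}]:=\Big\{A=(\alpha_{r-s})_{r,s=0}^{n-1}\ :\ \alpha_r\in\mathcal{A},\ \ p\,\alpha_{r-n}=q\,\alpha_r\Big\}$$ forms a left algebra in $\mathcal{T}_n[\mathcal{A}]$.
   Context: $\mathbb{H}$ is the division ring of real quaternions. For an algebra $\mathcal{A}$ in $\mathbb{H}$, $\mathcal{A}'$ denotes its commutant, the set of all quaternions commuting with each element of $\mathcal{A}$. $(\alpha_{r-s})_{r,s=0}^{n-1}$ is the $n\times n$ Toeplitz matrix whose $(r,s)$ entry is $\alpha_{r-s}$, with indices running from $0$ to $n-1$. $\mathcal{T}_n[\mathbb{H}]$ is the set of all $n\times n$ Toeplitz matrices with entries in $\mathbb{H}$, and $\mathcal{T}_n[\mathcal{A}]$ is the left vector space of those matrices in $\mathcal{T}_n[\mathbb{H}]$ with entries in $\mathcal{A}$. In the definition of $\mathcal{G}_{p,q}[\mathcal{A}]$, the condition $\alpha_r\in\mathcal{A}$ is for $1-n\le r\le n-1$ and the condition $p\alpha_{r-n}=q\alpha_r$ is for $1\le r\le n-1$. A left algebra of Toeplitz matrices is a class of Toeplitz matrices that has the structure of a left vector space as well as of a ring (under the usual matrix operations).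
   Formalization: The formal statement additionally assumes that p and q are not both zero; for p = q = 0 the family is all of T_n[A], which for n ≥ 2 and nonzero A is not closed under multiplication. *)

(* Defs.v *)
From HB Require Import structures.
From mathcomp Require Import all_boot all_order all_algebra.
From mathcomp Require Import ring lra.
From mathcomp Require Import mathcomp_extra boolp classical_sets reals.

Set Implicit Arguments.
Unset Strict Implicit.
Unset Printing Implicit Defensive.

Import Order.TTheory GRing.Theory Num.Theory.
Local Open Scope ring_scope.
Local Open Scope classical_set_scope.

(* [Quat a b c d] is a + b i + c j + d k. *)
Record quaternion (R : realType) :=
  Quat { qre : R; qi : R; qj : R; qk : R }.

Section Quaternion.
Variable R : realType.
Local Notation H := (quaternion R).
Implicit Types x y z : H.

Definition quat_to_tuple x : R * R * R * R := (qre x, qi x, qj x, qk x).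
Definition quat_of_tuple (t : R * R * R * R) : H :=
  let: (a, b, c, d) := t in Quat a b c d.
Lemma quat_to_tupleK : cancel quat_to_tuple quat_of_tuple.
Proof. by case. Qed.

HB.instance Definition _ := Choice.copy H (can_type quat_to_tupleK).

Definition addq x y :=
  Quat (qre x + qre y) (qi x + qi y) (qj x + qj y) (qk x + qk y).
Definition oppq x := Quat (- qre x) (- qi x) (- qj x) (- qk x).

Lemma addqA : associative addq.
Proof. by move=> [????] [????] [????]; rewrite /addq /= !addrA. Qed.
Lemma addqC : commutative addq.
Proof. by move=> [a b c d] [????]; congr Quat; rewrite /= addrC. Qed.
Lemma add0q : left_id (Quat 0 0 0 0) addq.
Proof. by move=> [????]; rewrite /addq /= !add0r. Qed.
Lemma addNq : left_inverse (Quat 0 0 0 0) oppq addq.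
Proof. by move=> [????]; rewrite /addq /= !addNr. Qed.

HB.instance Definition _ :=
  GRing.isZmodule.Build H addqA addqC add0q addNq.

Definition mulq x y := Quat
  (qre x * qre y - qi x * qi y - qj x * qj y - qk x * qk y)
  (qre x * qi y + qi x * qre y + qj x * qk y - qk x * qj y)
  (qre x * qj y - qi x * qk y + qj x * qre y + qk x * qi y)
  (qre x * qk y + qi x * qj y - qj x * qi y + qk x * qre y).

Lemma mulqA : associative mulq.
Proof. by move=> [????] [????] [????]; congr Quat => /=; ring. Qed.
Lemma mul1q : left_id (Quat 1 0 0 0) mulq.
Proof. by move=> [????]; congr Quat => /=; ring. Qed.
Lemma mulq1 : right_id (Quat 1 0 0 0) mulq.
Proof. by move=> [????]; congr Quat => /=; ring. Qed.
Lemma mulqDl : left_distributive mulq +%R.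
Proof. by move=> [????] [????] [????]; congr Quat => /=; ring. Qed.
Lemma mulqDr : right_distributive mulq +%R.
Proof. by move=> [????] [????] [????]; congr Quat => /=; ring. Qed.
Lemma oneq_neq0 : Quat 1 0 0 0 != 0 :> H.
Proof. by apply/eqP => -[] /eqP; rewrite oner_eq0. Qed.

HB.instance Definition _ := GRing.Zmodule_isNzRing.Build H
  mulqA mul1q mulq1 mulqDl mulqDr oneq_neq0.

Definition scaleq (a : R) x := Quat (a * qre x) (a * qi x) (a * qj x) (a * qk x).

Lemma scaleqA a b x : scaleq a (scaleq b x) = scaleq (a * b) x.
Proof. by rewrite /scaleq /= !mulrA. Qed.
Lemma scale1q : left_id 1 scaleq.
Proof. by case=> ????; rewrite /scaleq /= !mul1r. Qed.
Lemma scaleqDr : right_distributive scaleq +%R.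
Proof. by move=> ? [????] [????]; congr Quat => /=; ring. Qed.
Lemma scaleqDl x : {morph scaleq^~ x : a b / a + b}.
Proof. by move=> ??; congr Quat => /=; ring. Qed.

HB.instance Definition _ := GRing.Zmodule_isLmodule.Build R H
  scaleqA scale1q scaleqDr scaleqDl.

Lemma scaleqAl a x y : a *: (x * y) = (a *: x) * y.
Proof. by case: x y => [????] [????]; congr Quat => /=; ring. Qed.
HB.instance Definition _ := GRing.Lmodule_isLalgebra.Build R H scaleqAl.

Lemma scaleqAr a x y : a *: (x * y) = x * (a *: y).
Proof. by case: x y => [????] [????]; congr Quat => /=; ring. Qed.
HB.instance Definition _ := GRing.Lalgebra_isAlgebra.Build R H scaleqAr.

Definition normq2 x : R := qre x ^+ 2 + qi x ^+ 2 + qj x ^+ 2 + qk x ^+ 2.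
Definition conjq x := Quat (qre x) (- qi x) (- qj x) (- qk x).
Definition invq x := (normq2 x)^-1 *: conjq x.

Lemma normq2_eq0 x : (normq2 x == 0) = (x == 0).
Proof.
apply/eqP/eqP => [|->]; last by rewrite /normq2 /= !expr0n /= !addr0.
case: x => a b c d; rewrite /normq2 /= => h.
have [*] : [/\ a = 0, b = 0, c = 0 & d = 0].
  by split; apply/eqP; rewrite -sqrf_eq0 eq_le sqr_ge0 andbT;
    have := sqr_ge0 a; have := sqr_ge0 b; have := sqr_ge0 c;
    have := sqr_ge0 d; lra.
by subst.
Qed.

Lemma mulVq : {in [pred x : H | x != 0], left_inverse 1 invq *%R}.
Proof.
move=> x; rewrite inE -normq2_eq0 => n0.
rewrite /invq -scalerAl.
have -> : conjq x * x = normq2 x *: 1.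
  by case: {n0} x => ????; congr Quat; rewrite /normq2 /=; ring.
by rewrite scalerA mulVf // scale1r.
Qed.

Lemma mulqV : {in [pred x : H | x != 0], right_inverse 1 invq *%R}.
Proof.
move=> x; rewrite inE -normq2_eq0 => n0.
rewrite /invq -scalerAr.
have -> : x * conjq x = normq2 x *: 1.
  by case: {n0} x => ????; congr Quat; rewrite /normq2 /=; ring.
by rewrite scalerA mulVf // scale1r.
Qed.

Lemma unitqP x y : y * x = 1 /\ x * y = 1 -> x \in [pred x : H | x != 0].
Proof.
by move=> [+ _]; rewrite inE; apply: contra_eqN => /eqP ->; rewrite mulr0 eq_sym oner_eq0.
Qed.

Lemma invq_out : {in [predC [pred x : H | x != 0]], invq =1 id}.
Proof.
move=> x; rewrite !inE negbK => /eqP ->.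
by rewrite /invq; congr Quat; rewrite /= ?oppr0 mulr0.
Qed.

(* The units are exactly the nonzero quaternions: H is a division ring. *)
HB.instance Definition _ := GRing.NzRing_hasMulInverse.Build H
  mulVq mulqV unitqP invq_out.

End Quaternion.

(* A real subalgebra of H.  The unit is not required, so that A = {0} is
   allowed; every other such A contains 1, since |x|^2 = 2 Re(x) x - x^2. *)
Record is_algebra (R : realType) (A : set (quaternion R)) : Prop := IsAlgebra {
  algebra0 : A 0;
  algebraD : forall x y, A x -> A y -> A (x + y);
  algebraZ : forall (c : R) x, A x -> A (c *: x);
  algebraM : forall x y, A x -> A y -> A (x * y) }.

Definition commutant (R : realType) (A : set (quaternion R)) :
    set (quaternion R) :=
  [set z | forall a, A a -> GRing.comm z a].

Definition toeplitz_mx (R : realType) (n : nat) (alpha : int -> quaternion R) :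
    'M[quaternion R]_n :=
  \matrix_(r < n, s < n) alpha ((r : nat)%:Z - (s : nat)%:Z).

(* Only the values alpha r with 1 - n <= r <= n - 1 occur in the matrix. *)
Definition toeplitz (R : realType) (n : nat) (A : set (quaternion R)) :
    set 'M[quaternion R]_n :=
  [set M | exists2 alpha : int -> quaternion R,
     (forall r : int, 1 - n%:Z <= r <= n%:Z - 1 -> A (alpha r)) &
     M = toeplitz_mx n alpha].
Arguments toeplitz [R] n A.

Definition Gpq (R : realType) (n : nat) (p q : quaternion R)
    (A : set (quaternion R)) : set 'M[quaternion R]_n :=
  [set M | exists alpha : int -> quaternion R,
     [/\ (forall r : int, 1 - n%:Z <= r <= n%:Z - 1 -> A (alpha r)),
         (forall r : int, 1 <= r <= n%:Z - 1 ->
            p * alpha (r - n%:Z) = q * alpha r) &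
         M = toeplitz_mx n alpha]].
Arguments Gpq [R] n p q A.

(* S is a class of Toeplitz matrices that is a left vector space over A and a
   ring.  The operations are those of the ambient matrix ring, so the axioms
   beyond closure and existence of an identity are inherited.  Since the zero
   algebra is allowed, the identity of S is not required to be 1%:M; when A
   is nonzero, 1%:M is itself a member of T_n[A].  [a *: M] multiplies every
   entry of M by a on the left. *)
Record left_algebra (R : realType) (n : nat) (A : set (quaternion R))
    (S : set 'M[quaternion R]_n) : Prop := LeftAlgebra {
  left_algebra_toeplitz : S `<=` toeplitz n setT;
  left_algebra0 : S 0;
  left_algebraD : forall M N, S M -> S N -> S (M + N);
  left_algebraN : forall M, S M -> S (- M);
  left_algebraZ : forall a M, A a -> S M -> S (a *: M);
  left_algebraM : forall M N, S M -> S N -> S (M *m N);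
  left_algebra1 : exists2 E, S E &
    forall M, S M -> E *m M = M /\ M *m E = M }.

Definition left_algebra_in (R : realType) (n : nat) (A : set (quaternion R))
    (S T : set 'M[quaternion R]_n) : Prop :=
  S `<=` T /\ left_algebra A S.

(* Main.v *)
Require Import Defs.
From HB Require Import structures.
From mathcomp Require Import all_boot all_order all_algebra.
From mathcomp Require Import zify ring.
From mathcomp Require Import mathcomp_extra boolp classical_sets reals.

Set Implicit Arguments.
Unset Strict Implicit.
Unset Printing Implicit Defensive.

Import Order.TTheory GRing.Theory Num.Theory.
Local Open Scope ring_scope.
Local Open Scope classical_set_scope.

(** The only point that is not entrywise is closure under products.  Write
    [c r s] for the [(r, s)] entry of the product of the Toeplitz matrices
    with symbols [a] and [b], both satisfying the wrap-around relation
    [p * a (r - n) = q * a r].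

    The product is Toeplitz exactly when [c r.+1 s.+1 = c r s].  Shifting the
    summation index, the two sums share all terms but one, and their
    difference is
      [X = a (r + 1) * b (- (s + 1)) - a (r + 1 - n) * b (n - (s + 1))].
    Since [p] and [q] commute with the values of [a], the relations for [a]
    and [b] give both [p * X = 0] and [q * X = 0]; as one of [p], [q] is an
    invertible quaternion, [X = 0] ([toeplitz_conv_shift]).  Treating [p] and
    [q] at the same time avoids dividing by the one that is nonzero.

    The wrap-around relation passes to the product because [p * c 0 (n - r)]
    and [q * c r 0] are the same sum up to a cyclic rotation of the summation
    index by [r]: a term that does not wrap is matched by the relation for
    [b], a term that wraps is matched by the relation for [a]
    ([toeplitz_conv_wrap]).

    The identity matrix has the symbol that is [1] at [0] and [0] elsewhere,
    so it lies in the class as soon as [1] lies in the algebra, which is the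
    case unless the algebra is zero ([is_algebra_one]); in that case the class
    is the zero ring. *)

(** * Products of Toeplitz matrices with wrapped symbols *)

Definition wrapped (K : nzRingType) (n : nat) (p q : K) (a : int -> K) :=
  forall r : int, 1 <= r <= n%:Z - 1 -> p * a (r - n%:Z) = q * a r.

Definition toeplitz_conv (K : nzRingType) (n : nat) (a b : int -> K)
    (r s : nat) : K :=
  \sum_(0 <= k < n) a (r%:Z - k%:Z) * b (k%:Z - s%:Z).

(** The regularity hypothesis on the pair [(p, q)] is how [p != 0 \/ q != 0]
    is used in a division ring. *)
Lemma toeplitz_conv_shift (K : nzRingType) (n : nat) (p q : K)
    (a b : int -> K) (r s : nat) :
    (forall x, p * x = 0 -> q * x = 0 -> x = 0) ->
    (forall t : int, 1 - n%:Z <= t <= n%:Z - 1 ->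
       GRing.comm p (a t) /\ GRing.comm q (a t)) ->
    wrapped n p q a -> wrapped n p q b ->
    (r.+1 < n)%N -> (s.+1 < n)%N ->
  toeplitz_conv n a b r.+1 s.+1 = toeplitz_conv n a b r s.
Proof.
case: n => [|m] // reg com wa wb ltr lts; rewrite /toeplitz_conv.
rewrite big_nat_recl // [RHS]big_nat_recr //= addrC.
have -> : \sum_(0 <= k < m)
    a (r.+1%:Z - k.+1%:Z) * b (k.+1%:Z - s.+1%:Z) =
    \sum_(0 <= k < m) a (r%:Z - k%:Z) * b (k%:Z - s%:Z).
  by apply: eq_bigr => k _; congr (a _ * b _); lia.
congr (_ + _); apply/eqP; rewrite -subr_eq0; apply/eqP.
have := wa r.+1%:Z; have := wb (m%:Z - s%:Z).
have -> : m%:Z - s%:Z - m.+1%:Z = 0%:Z - s.+1%:Z by lia.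
have -> : r.+1%:Z - m.+1%:Z = r%:Z - m%:Z by lia.
rewrite subr0 => /(_ ltac:(lia)) Wb /(_ ltac:(lia)) Wa.
have [ca1 ca2] := com (r%:Z - m%:Z) ltac:(lia).
have [cb1 cb2] := com r.+1%:Z ltac:(lia).
apply: reg; rewrite mulrBr !mulrA.
  by rewrite Wa cb1 cb2 -!mulrA Wb subrr.
by rewrite -Wa ca1 ca2 -!mulrA Wb subrr.
Qed.

Lemma toeplitz_conv_diag (K : nzRingType) (n : nat) (p q : K)
    (a b : int -> K) (r s d : nat) :
    (forall x, p * x = 0 -> q * x = 0 -> x = 0) ->
    (forall t : int, 1 - n%:Z <= t <= n%:Z - 1 ->
       GRing.comm p (a t) /\ GRing.comm q (a t)) ->
    wrapped n p q a -> wrapped n p q b ->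
    (r + d < n)%N -> (s + d < n)%N ->
  toeplitz_conv n a b (r + d) (s + d) = toeplitz_conv n a b r s.
Proof.
move=> reg com wa wb; elim: d => [|d IH]; first by rewrite !addn0.
rewrite !addnS => ltr lts.
by rewrite (toeplitz_conv_shift reg com wa wb) // IH // ltnW.
Qed.

(** The two sums match under [k |-> k + r] modulo [n]; the relation for [b]
    accounts for [k < n - r] and the relation for [a] for the other [k]. *)
Lemma toeplitz_conv_wrap (K : nzRingType) (n : nat) (p q : K)
    (a b : int -> K) (r : nat) :
    (forall t : int, 1 - n%:Z <= t <= n%:Z - 1 ->
       GRing.comm p (a t) /\ GRing.comm q (a t)) ->
    wrapped n p q a -> wrapped n p q b -> (0 < r < n)%N ->
  p * toeplitz_conv n a b 0 (n - r) = q * toeplitz_conv n a b r 0.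
Proof.
have shift m (F : nat -> K) :
    \sum_(m <= k < n) F k = \sum_(0 <= k < n - m) F (k + m)%N.
  by rewrite -{1}[m]add0n big_addn.
move=> com wa wb hr; rewrite /toeplitz_conv !big_distrr /=.
rewrite (@big_cat_nat _ _ _ (n - r)%N) ?leq_subr //=.
rewrite [RHS](@big_cat_nat _ _ _ r) //=; last by lia.
rewrite [RHS]addrC; congr (_ + _).
  (* Here [k] and [k + r] both lie below [n]: the two factors [a] agree, and
     [p] moves past [a] to act on [b]. *)
  rewrite [RHS]shift !big_nat; apply: eq_bigr => k hk.
  have [c1 c2] := com (0%:Z - k%:Z) ltac:(lia).
  have := wb (k + r)%N%:Z.
  have -> : (k + r)%N%:Z - n%:Z = k%:Z - (n - r)%N%:Z by lia.
  move=> /(_ ltac:(lia)) Wb.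
  have -> : r%:Z - (k + r)%N%:Z = 0%:Z - k%:Z by lia.
  by rewrite subr0 !mulrA c1 c2 -!mulrA Wb.
(* Here the rotation passes the end of the range: the two factors [b] agree,
   and the arguments of the factors [a] differ by [n]. *)
rewrite [LHS]shift; have -> : (n - (n - r) = r)%N by lia.
rewrite !big_nat; apply: eq_bigr => k hk.
have := wa (r%:Z - k%:Z).
have -> : r%:Z - k%:Z - n%:Z = 0%:Z - (k + (n - r))%N%:Z by lia.
move=> /(_ ltac:(lia)) Wa.
have -> : (k + (n - r))%N%:Z - (n - r)%N%:Z = k%:Z - 0%:Z by lia.
by rewrite !mulrA Wa.
Qed.

(** * The class of Toeplitz matrices *)

(** The Cayley-Hamilton identity [|x|^2 = 2 Re(x) x - x^2] expresses a nonzero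
    real scalar in terms of any [x != 0] of the algebra. *)
Lemma is_algebra_one (R : realType) (A : set (quaternion R)) x :
  is_algebra A -> A x -> x != 0 -> A 1.
Proof.
move=> hA Ax; rewrite -normq2_eq0 => nx.
have -> : 1 = (normq2 x)^-1 *: ((2 * qre x) *: x + (-1) *: (x * x)).
  have -> : (2 * qre x) *: x + (-1) *: (x * x) = normq2 x *: 1.
    by case: x {Ax nx} => a b c d; congr Quat; rewrite /normq2 /=; ring.
  by rewrite scalerA mulVf // scale1r.
apply: (algebraZ hA); apply: (algebraD hA); apply: (algebraZ hA) => //.
exact: (algebraM hA).
Qed.

(** The only place where [p != 0 \/ q != 0] matters: if [p = q = 0], the
    class is that of all Toeplitz matrices over [A], which need not be closed
    under products. *)
Lemma Gpq_mul (R : realType) (n : nat) (A : set (quaternion R))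
    (p q : quaternion R) (M N : 'M[quaternion R]_n) :
    is_algebra A -> commutant A p -> commutant A q -> p != 0 \/ q != 0 ->
  Gpq n p q A M -> Gpq n p q A N -> Gpq n p q A (M *m N).
Proof.
move=> hA hp hq hpq [a [aA wa ->]] [b [bA wb ->]].
have cancel0 (y x : quaternion R) : y != 0 -> y * x = 0 -> x = 0.
  (* In a division ring, being a unit unfolds to being nonzero. *)
  move=> ny yx; have uy : y \is a GRing.unit by exact: ny.
  by rewrite -[x](mulKr uy) yx mulr0.
have reg (x : quaternion R) : p * x = 0 -> q * x = 0 -> x = 0.
  by case: hpq => nz px qx; apply: cancel0 nz _.
have com (t : int) : 1 - n%:Z <= t <= n%:Z - 1 ->
    GRing.comm p (a t) /\ GRing.comm q (a t).
  by move=> ht; split; [apply: hp | apply: hq]; apply: aA.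
have convA (r s : nat) : (r < n)%N -> (s < n)%N -> A (toeplitz_conv n a b r s).
  move=> ltr lts; rewrite /toeplitz_conv big_nat.
  apply: (big_ind A) => [|x y|k hk]; first exact: algebra0.
    exact: algebraD.
  by apply: (algebraM hA); [apply: aA | apply: bA]; lia.
(* The symbol of the product is read off its first column and first row;
   [`|m|] is the position on either of them. *)
exists (fun m : int => if 0 <= m then toeplitz_conv n a b `|m|%N 0
                       else toeplitz_conv n a b 0 `|m|%N); split.
- by move=> r hr; case: ifP => r0; apply: convA; lia.
- move=> r hr; rewrite ifF; last by lia.
  rewrite ifT; last by lia.
  have -> : `|(r - n%:Z)%R|%N = (n - `|r|)%N by lia.
  by apply: toeplitz_conv_wrap => //; lia.
apply/matrixP => i j; rewrite !mxE.
have -> : \sum_k toeplitz_mx n a i k * toeplitz_mx n b k j =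
    toeplitz_conv n a b i j.
  rewrite /toeplitz_conv big_mkord.
  by apply: eq_bigr => k _; rewrite !mxE.
have [lti ltj] := (ltn_ord i, ltn_ord j).
case: ifP => ij.
  rewrite -[RHS](toeplitz_conv_diag (d := j) reg com wa wb); try lia.
  by congr toeplitz_conv; lia.
rewrite -[RHS](toeplitz_conv_diag (d := i) reg com wa wb); try lia.
by congr toeplitz_conv; lia.
Qed.

Lemma Gpq_one (R : realType) (n : nat) (A : set (quaternion R))
    (p q : quaternion R) : is_algebra A -> A 1 -> Gpq n p q A 1%:M.
Proof.
move=> hA A1; exists (fun r : int => (r == 0)%:R); split.
- by move=> r _; case: (r == 0) => //; apply: algebra0.
- move=> r hr; have /negPf -> : r != 0 by lia.
  have /negPf -> : r - n%:Z != 0 by lia.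
  by rewrite !mulr0.
- apply/matrixP => i j; rewrite !mxE; congr (_%:R).
  by congr nat_of_bool; rewrite subr_eq0 eqz_nat.
Qed.

Theorem theorem4p2 (R : realType) (n : nat) (A : set (quaternion R))
    (p q : quaternion R) (hA : is_algebra A)
    (hp : commutant A p) (hq : commutant A q) (hpq : p != 0 \/ q != 0) :
  left_algebra_in A (Gpq n p q A) (toeplitz n A).
Proof.
have AN (x : quaternion R) : A x -> A (- x).
  by rewrite -scaleN1r; apply: algebraZ.
split; first by move=> M [a [aA _ ->]]; exists a.
have G0 : Gpq n p q A 0.
  exists (fun=> 0); split=> [r _|r _|]; first exact: algebra0.
    by rewrite !mulr0.
  by apply/matrixP => i j; rewrite !mxE.
split=> //.
- by move=> M [a [_ _ ->]]; exists a.
- move=> M N [a [aA wa ->]] [b [bA wb ->]].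
  exists (fun r => a r + b r); split=> [r hr|r hr|].
  + by apply: (algebraD hA); [apply: aA | apply: bA].
  + by rewrite !mulrDr wa // wb.
  + by apply/matrixP => i j; rewrite !mxE.
- move=> M [a [aA wa ->]]; exists (fun r => - a r); split=> [r hr|r hr|].
  + exact/AN/aA.
  + by rewrite !mulrN wa.
  + by apply/matrixP => i j; rewrite !mxE.
- move=> x M Ax [a [aA wa ->]]; exists (fun r => x * a r); split=> [r hr|r hr|].
  + by apply: (algebraM hA) => //; apply: aA.
  + by rewrite !mulrA (hp _ Ax) (hq _ Ax) -!mulrA wa.
  + by apply/matrixP => i j; rewrite !mxE.
- by move=> M N; apply: Gpq_mul.
have [[x [Ax nx]]|Atriv] := pselect (exists x, A x /\ x != 0).
  exists 1%:M; first exact: (Gpq_one n p q hA (is_algebra_one hA Ax nx)).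
  by move=> M _; rewrite mul1mx mulmx1.
exists 0 => // M [a [aA _ ->]].
suff -> : toeplitz_mx n a = 0 by rewrite mul0mx.
apply/matrixP => i j; rewrite !mxE; apply/eqP/negPn/negP => nz.
have [lti ltj] := (ltn_ord i, ltn_ord j).
by apply: Atriv; exists (a (i%:Z - j%:Z)); split=> //; apply: aA; lia.
Qed.
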